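(* Let $n\geq 15$ with $n\equiv 3\pmod 4$ and $r=6$. Let $V=\{x_1,\dots,x_{n-10}\}\sqcup\{a,b,c,d,e,f,g,h,k,m\}$ and consider the labelled graph on $V$ with edges: a terminal-1 alternating path on $x_1,\dots,x_{n-10}$; $\{x_{n-10},a\}$ with label $2$; $\{a,b\}$ with label $3$; $\{b,c\}$ with label $4$; $\{c,d\}$ with label $5$; $\{e,f\}$ with label $5$; $\{f,g\}$ with label $4$; $\{c,e\}$ and $\{d,f\}$ with label $3$; $\{h,k\}$ with label $5$; $\{k,m\}$ with label $4$; $\{h,e\}$ with the two labels $2$ and $4$; $\{k,f\}$ with label $2$; and $\{m,g\}$ with the three labels $2,3,5$. Then $G\cong A_n$ and $(G,(\rho_0,\dots,\rho_5))$ is a string C-group of rank 6 with Schläfli type $\{n-10,6,3,5,3\}$.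
   Context: A string group generated by involutions (sggi) of rank $r$ is a pair $(G,(\rho_0,\dots,\rho_{r-1}))$ where $\rho_0,\dots,\rho_{r-1}$ are involutions generating the group $G$ such that $(\rho_i\rho_j)^2=1$ whenever $|i-j|\geq 2$. It is a string C-group if in addition it satisfies the intersection property: for all $J,K\subseteq\{0,\dots,r-1\}$, $\langle \rho_j : j\in J\rangle\cap\langle\rho_k : k\in K\rangle=\langle \rho_j : j\in J\cap K\rangle$. The Schläfli type is $\{p_1,\dots,p_{r-1}\}$ where $p_i$ is the order of $\rho_{i-1}\rho_i$. Labelled-graph convention: the vertex set $V$ is finite, and each edge $\{a,b\}$ ($a\neq b$) carries one or more labels from $\{0,\dots,r-1\}$, the edges carrying any given label being pairwise disjoint; $\rho_k$ denotes the permutation of $V$ equal to the product of the transpositions $(a\,b)$ over all edges $\{a,b\}$ carrying label $k$, and $G=\langle\rho_0,\dots,\rho_{r-1}\rangle\leq \mathrm{Sym}(V)$. A terminal-1 alternating path on vertices $v_1,\dots,v_a$ means the edges $\{v_s,v_{s+1}\}$ ($1\leq s\leq a-1$), where $\{v_s,v_{s+1}\}$ carries label $1$ if $a-s$ is odd and label $0$ if $a-s$ is even (so the last edge carries label 1 and labels alternate; if $a=1$ there are no edges). *)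

(* Defs.v *)
From HB Require Import structures.
From mathcomp Require Import all_boot all_order all_fingroup all_solvable.
Set Implicit Arguments. Unset Strict Implicit. Unset Printing Implicit Defensive.
Local Open Scope group_scope.

Definition sggi (gT : finGroupType) (r : nat) (rho : nat -> gT) : Prop :=
  (forall i, (i < r)%N -> #[rho i] = 2%N) /\
  (forall i j, (i < r)%N -> (j < r)%N -> (i.+2 <= j)%N || (j.+2 <= i)%N ->
     (rho i * rho j) ^+ 2 = 1).

Definition gens_of (gT : finGroupType) (r : nat) (rho : nat -> gT)
  (J : {set 'I_r}) : {set gT} := [set rho (nat_of_ord j) | j in J].

Definition intersection_property (gT : finGroupType) (r : nat) (rho : nat -> gT) : Prop :=
  forall J K : {set 'I_r},
    <<gens_of rho J>> :&: <<gens_of rho K>> = <<gens_of rho (J :&: K)>>.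

(* (G, (rho_0,...,rho_{r-1})) with G := <<rho_0,...,rho_{r-1}>> *)
Definition string_C_group (gT : finGroupType) (r : nat) (rho : nat -> gT) : Prop :=
  sggi r rho /\ intersection_property r rho.

Definition schlafli (gT : finGroupType) (r : nat) (rho : nat -> gT) : seq nat :=
  [seq #[rho i * rho i.+1] | i <- iota 0 r.-1].

(* transposition (i j) of 'I_N (identity if out of range; never happens below) *)
Definition tp (N : nat) (i j : nat) : {perm 'I_N} :=
  match @insub nat (fun x => x < N)%N _ i, @insub nat (fun x => x < N)%N _ j with
  | Some oi, Some oj => tperm oi oj
  | _, _ => 1
  end.

(* Vertex encoding in 'I_n: x_s (1 <= s <= n-10) is s-1;
   a,b,c,d,e,f,g,h,k,m are n-10, ..., n-1 respectively. *)
Definition vx (n s : nat) := s.-1.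
Definition va (n : nat) := (n - 10)%N.
Definition vb (n : nat) := (n - 9)%N.
Definition vc (n : nat) := (n - 8)%N.
Definition vd (n : nat) := (n - 7)%N.
Definition ve (n : nat) := (n - 6)%N.
Definition vf (n : nat) := (n - 5)%N.
Definition vg (n : nat) := (n - 4)%N.
Definition vh (n : nat) := (n - 3)%N.
Definition vk (n : nat) := (n - 2)%N.
Definition vm (n : nat) := (n - 1)%N.

(* terminal-1 alternating path on x_1..x_A, A = n-10: edge {x_s,x_{s+1}}
   (1 <= s <= A-1) has label 1 if A-s odd, label 0 if A-s even. *)
Definition path_edges (n lab : nat) : seq (nat * nat) :=
  [seq (vx n s, vx n s.+1) | s <- iota 1 (n - 10).-1 &
     odd ((n - 10) - s) == (lab == 1%N)].

Definition edges (n lab : nat) : seq (nat * nat) :=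
  match lab with
  | 0 => path_edges n 0
  | 1 => path_edges n 1
  | 2 => [:: (vx n (n - 10), va n); (vh n, ve n); (vk n, vf n); (vm n, vg n)]
  | 3 => [:: (va n, vb n); (vc n, ve n); (vd n, vf n); (vm n, vg n)]
  | 4 => [:: (vb n, vc n); (vf n, vg n); (vh n, ve n); (vk n, vm n)]
  | 5 => [:: (vc n, vd n); (ve n, vf n); (vh n, vk n); (vm n, vg n)]
  | _ => [::]
  end.

Definition rho (n : nat) (lab : nat) : {perm 'I_n} :=
  \prod_(p <- edges n lab) tp n p.1 p.2.

(* Main.v *)
(* The labels 2, ..., 5 act on the eleven vertices x_{n-10}, a, ..., m as L = PSL(2,11)
   (the group of the 11-cell), the labels 0 and 1 generate a dihedral group D on the path,
   and the two supports X and Y meet only in p = x_{n-10}. Let A <= D and B <= L.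
   If A or B fixes p, then A and B commute and <A, B> = AB. Otherwise commutators of
   elements of A and B moving p are 3-cycles (p u v), and these generate the alternating group
   on the union U of the A-orbit and the B-orbit of p; all generators being even, <A, B> is
   then the set of even permutations that agree outside U with some ab, a in A, b in B.
   So the whole group is A_n, and the intersection property for the standard subgroups
   <A, B> reduces to the one for D and the one for L. The reduction needs that a parabolic
   subgroup of D or L other than D, L has an orbit of p missing a set of points whose pointwise
   stabiliser is trivial: x_1, x_2 in D, and in L the block {d, f, g, k, m} of an invariant
   biplane. *)

Require Import Defs.
From HB Require Import structures.
From mathcomp Require Import all_boot all_order all_fingroup all_solvable zify.
Set Implicit Arguments. Unset Strict Implicit. Unset Printing Implicit Defensive.
Local Open Scope group_scope.

(** * Alternating groups from star 3-cycles *)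

Section StarGeneration.

Variables (T : finType) (H : {group {perm T}}) (p : T) (A B : {set T}).
Variables (u0 v0 : T).
Hypotheses (Au0 : u0 \in A) (Bv0 : v0 \in B).
Hypotheses (pA : p \notin A) (pB : p \notin B).
Hypothesis starAB :
  {in A & B, forall u v, tperm p u * tperm p v \in H}.

(** Two points of the same set are linked through a point of the other one: [(p u)(p v0)] times
    [(p v0)(p v)] is [(p u)(p v)], and likewise with [u0]. *)
Lemma star_mem : {in A :|: B &, forall u v, tperm p u * tperm p v \in H}.
Proof.
have revAB u v : u \in A -> v \in B -> tperm p v * tperm p u \in H.
  by move=> Au Bv; rewrite -groupV invMg !tpermV starAB.
have via w u v : tperm p u * tperm p w \in H -> tperm p w * tperm p v \in H ->
    tperm p u * tperm p v \in H.
  by move=> uw wv; have := groupM uw wv; rewrite -mulgA (mulgA (tperm p w)) tperm2 mul1g.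
move=> u v; rewrite !inE => /orP[Au|Bu] /orP[Av|Bv].
- by apply: (via v0); [apply: starAB | apply: revAB].
- exact: starAB.
- exact: revAB.
- by apply: (via u0); [apply: revAB | apply: starAB].
Qed.

(** When neither [x] nor [y] is [p], [(x y)] equals [(p x)(p y)(p x)], so the product splits into
    two pairs of star transpositions. *)
Lemma tperm_star_mem x y w : x != y ->
  x \in p |: (A :|: B) -> y \in p |: (A :|: B) -> w \in A :|: B ->
  tperm x y * tperm p w \in H.
Proof.
move=> xy /setU1P[xp | ABx] /setU1P[yp | ABy] ABw; rewrite ?xp.
- by rewrite xp yp eqxx in xy.
- exact: star_mem.
- by rewrite yp tpermC star_mem.
have px : p != x by apply: contraTneq ABx => <-; rewrite inE negb_or pA.
have py : p != y by apply: contraTneq ABy => <-; rewrite inE negb_or pA.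
have -> : tperm x y = tperm p x * tperm p y * tperm p x.
  have := tpermJ p y (tperm p x).
  by rewrite tpermL (tpermD py xy) /conjg tpermV mulgA => ->.
by rewrite -mulgA groupM ?star_mem.
Qed.

Lemma even_mem_star h : perm_on (p |: (A :|: B)) h -> ~~ odd_perm h -> h \in H.
Proof.
move=> onh evh.
have ABu : u0 \in A :|: B by rewrite inE Au0.
(* The induction on the number of moved points alternates parity, so odd permutations are included,
   corrected by one fixed star transposition. *)
suff: h * (if odd_perm h then tperm p u0 else 1) \in H.
  by rewrite (negPf evh) mulg1.
elim: {h evh}_.+1 {-2}h (ltnSn #|[pred z | h z != z]|) onh => // k IH h.
rewrite ltnS => lek onh.
have [x hx | fixh] := pickP [pred z | h z != z]; last first.
  have -> : h = 1 by apply/permP=> z; rewrite perm1; apply/eqP/negbFE/fixh.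
  by rewrite odd_perm1 mulg1.
have xy : x != h x by rewrite eq_sym.
have Ux : x \in p |: (A :|: B) by apply: (subsetP onh).
have Uy : h x \in p |: (A :|: B) by rewrite perm_closed.
(* Multiplying by [t] makes [x] a fixed point, moves no new point and flips the parity. *)
pose t := tperm x (h x); pose h' := h * t.
have onh' : perm_on (p |: (A :|: B)) h'.
  apply: perm_onM => //; apply: subset_trans (tperm_on _ _) _.
  by apply/subsetP=> z /set2P[] ->.
have lth' : (#|[pred z | h' z != z]| < k)%N.
  apply: leq_trans lek; apply: proper_card; apply/properP; split; last first.
    by exists x; rewrite // inE permM tpermR eqxx.
  apply/subsetP=> z; rewrite !inE; apply: contra => /eqP hz.
  rewrite permM hz tpermD // ?(contra_neq _ xy) // => zE.
    by rewrite zE.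
  by apply: (@perm_inj _ h); rewrite zE.
have oddh' : odd_perm h' = ~~ odd_perm h by rewrite odd_permM odd_tperm xy addbT.
have hE : h = h' * t by rewrite -mulgA tperm2 mulg1.
have := IH _ lth' onh'; rewrite oddh'.
case: (odd_perm h) => /= Hh'.
  by rewrite [h]hE -mulgA groupM ?tperm_star_mem // -[h']mulg1.
rewrite mulg1 [h]hE -(mulgK (tperm p u0) h') -mulgA groupM //.
by rewrite -groupV invMg invgK tpermV tperm_star_mem.
Qed.

End StarGeneration.

(** * Permutation groups sharing one point *)

Section Amalgam.

Variables (T : finType) (p : T) (X Y : {set T}).
Hypotheses (Xp : p \in X) (Yp : p \in Y).
Hypothesis XY : forall z, z \in X -> z \in Y -> z = p.

Implicit Types (A B : {group {perm T}}) (a b g : {perm T}).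

Notation porb A := (orbit 'P (gval A) p).

Definition even_on (S : {set T}) A :=
  {in A, forall a, perm_on S a /\ ~~ odd_perm a}.

Lemma notinY z : z \in X -> z != p -> z \notin Y.
Proof. by move=> Xz; apply: contra => Yz; rewrite (XY Xz Yz). Qed.

Lemma notinX z : z \in Y -> z != p -> z \notin X.
Proof. by move=> Yz; apply: contra => Xz; rewrite (XY Xz Yz). Qed.

Lemma porb_p A : p \in porb A.
Proof. exact: orbit_refl. Qed.

Lemma porb_act A a z : a \in A -> (a z \in porb A) = (z \in porb A).
Proof.
have act c y : c \in A -> y \in porb A -> c y \in porb A.
  by move=> Ac /orbitP[d Ad <-]; apply/orbitP; exists (d * c); rewrite ?groupM //= !apermE permM.
move=> Aa; apply/idP/idP=> [Oaz | ]; last exact: act.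
by rewrite -(permK a z) act ?groupV.
Qed.

Lemma mulXE a b z : perm_on X a -> perm_on Y b -> z \in X ->
  (a z != p) || (b p == p) -> (a * b) z = a z.
Proof.
move=> ona onb Xz; rewrite permM; have Xaz : a z \in X by rewrite perm_closed.
by case: (eqVneq (a z) p) => [-> /= /eqP // | azp _]; rewrite (out_perm onb) ?notinY.
Qed.

Lemma mulYE a b z : perm_on X a -> perm_on Y b -> z \in Y ->
  (z != p) || (a p == p) -> (a * b) z = b z.
Proof.
move=> ona onb Yz; rewrite permM.
by case: (eqVneq z p) => [-> /= /eqP -> // | zp _]; rewrite (out_perm ona) ?notinX.
Qed.

Lemma eq_perm_off1 (s t : {perm T}) q : (forall z, z != q -> s z = t z) -> s = t.
Proof.
move=> st; have: s * t^-1 = 1.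
  apply: (@perm_on_id _ _ [set q]); last by rewrite cards1.
  apply/subsetP=> z; rewrite !inE permM; apply: contraNT => /st ->.
  by rewrite permK.
by move/eqP; rewrite -eq_mulgV1 => /eqP.
Qed.

(* When the supports of a and b meet only in p, this commutator is the 3-cycle
   sending p to a p and a p to b p. *)
Lemma commutator_star a b : perm_on X a -> perm_on Y b -> a p != p -> b p != p ->
  tperm p (a p) * tperm p (b p) = b^-1 * a^-1 * b * a.
Proof.
move=> ona onb ap bp.
have onaV := perm_onV ona; have onbV := perm_onV onb.
have Xap : a p \in X by rewrite perm_closed.
have Ybp : b p \in Y by rewrite perm_closed.
have fixa z : z \in Y -> z != p -> a z = z by move=> Yz zp; rewrite (out_perm ona) ?notinX.
have fixb z : z \in X -> z != p -> b z = z by move=> Xz zp; rewrite (out_perm onb) ?notinY.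
have fixaV z : z \in Y -> z != p -> a^-1 z = z by move=> Yz zp; rewrite (out_perm onaV) ?notinX.
have fixbV z : z \in X -> z != p -> b^-1 z = z by move=> Xz zp; rewrite (out_perm onbV) ?notinY.
have apV : a^-1 p != p by rewrite (can2_eq (permKV a) (permK a)) eq_sym.
have bpV : b^-1 p != p by rewrite (can2_eq (permKV b) (permK b)) eq_sym.
have apbp : a p != b p by apply: contra_neq ap => E; apply: XY; rewrite // E.
apply/permP=> z; rewrite !permM.
have [-> | zp] := eqVneq z p.
  by rewrite tpermL tpermD 1?eq_sym // (fixaV (b^-1 p)) ?permKV // perm_closed.
have [-> | zap] := eqVneq z (a p).
  by rewrite tpermR tpermL fixbV // permK fixa.
have [-> | zbp] := eqVneq z (b p).
  rewrite (tpermD _ apbp) 1?eq_sym // tpermR permK fixb ?permKV // ?perm_closed //.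
rewrite !(tpermD, eq_sym _ z) 1?(eq_sym p) //.
have [Xz | nXz] := boolP (z \in X).
  rewrite fixbV // fixb ?permKV // ?perm_closed //.
  by apply: contraNneq zap => <-; rewrite permKV.
have [Yz | nYz] := boolP (z \in Y); last by rewrite (out_perm onbV) // (out_perm onaV) // (out_perm onb) // (out_perm ona).
rewrite fixaV ?permKV ?(out_perm ona) // ?perm_closed //.
by apply: contraNneq zbp => <-; rewrite permKV.
Qed.

(** * The subgroup generated by two groups whose supports meet in [p] *)

Section TwoGroups.

Variables A B : {group {perm T}}.
Hypotheses (evA : even_on X A) (evB : even_on Y B).

(** If one group fixes [p], the two supports are disjoint, so the groups commute and their join is
    the product set. *)
Lemma amalgam_disjoint g :
  porb A = [set p] \/ porb B = [set p] -> g \in A <*> B ->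
  exists a b, [/\ a \in A, b \in B, g = a * b,
    {in X, forall z, z != p -> g z = a z} & {in Y, forall z, z != p -> g z = b z}].
Proof.
have fixp C c : porb C = [set p] -> c \in C -> c p = p.
  by move=> fC Cc; apply/set1P; rewrite -fC porb_act ?porb_p.
move=> fAB.
have fp a b : a \in A -> b \in B -> (a p == p) || (b p == p).
  by move=> Aa Bb; case: fAB => [/fixp/(_ Aa)-> | /fixp/(_ Bb)->]; rewrite eqxx ?orbT.
have EX a b z : a \in A -> b \in B -> z \in X -> z != p -> (a * b) z = a z.
  move=> Aa Bb Xz zp; have [[ona _] [onb _]] := (evA Aa, evB Bb).
  apply: mulXE => //; case/orP: (fp _ _ Aa Bb) => [/eqP ap | ->]; rewrite ?orbT //.
  by rewrite -[X in _ != X]ap (inj_eq perm_inj) zp.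
have EY a b z : a \in A -> b \in B -> z \in Y -> z != p -> (a * b) z = b z.
  by move=> Aa Bb Yz zp; have [[ona _] [onb _]] := (evA Aa, evB Bb); rewrite mulYE ?zp.
have cAB : B \subset 'C(A).
  apply/centsP=> b Bb a Aa; have [[ona _] [onb _]] := (evA Aa, evB Bb).
  apply: (@eq_perm_off1 _ _ p) => z zp.
  have [Xz | nXz] := boolP (z \in X).
    by rewrite (EX a b) // permM (out_perm onb) ?notinY.
  have [Yz | nYz] := boolP (z \in Y); last first.
    by rewrite !permM !((out_perm ona, out_perm onb)) // !((out_perm ona, out_perm onb)).
  rewrite (EY a b) // permM; have [bzp | bzp] := eqVneq (b z) p; last first.
    by rewrite (out_perm ona) ?notinX // perm_closed.
  rewrite bzp; case/orP: (fp _ _ Aa Bb) => /eqP // bp.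
  by case/eqP: zp; apply: (@perm_inj _ b); rewrite bzp.
rewrite cent_joinEr // => /mulsgP[a b Aa Bb gE].
by exists a, b; split=> // z Zz zp; rewrite gE; [apply: EX | apply: EY].
Qed.

Hypotheses (mvA : porb A != [set p]) (mvB : porb B != [set p]).

Definition agree_off g a b :=
  {in X, forall z, z \notin porb A -> g z = a z} /\
  {in Y, forall z, z \notin porb B -> g z = b z} /\
  (forall z, z \notin X -> z \notin Y -> g z = z).

Lemma agree_mul a b : a \in A -> b \in B -> agree_off (a * b) a b.
Proof.
move=> Aa Bb; have [[ona _] [onb _]] := (evA Aa, evB Bb).
split=> [z Xz Oz|]; [|split=> [z Yz Oz|z nXz nYz]].
- by rewrite mulXE // (contraNneq _ Oz) // => azp; rewrite -(porb_act z Aa) azp porb_p.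
- by rewrite mulYE // (contraNneq _ Oz) // => ->; apply: porb_p.
by rewrite permM (out_perm ona) ?(out_perm onb).
Qed.

(** The condition defines a group, since the orbits are stable, and this group contains [A] and [B].
    Conversely, dividing such a [g] by [a * b] leaves an even permutation supported on the union of
    the two orbits, where the star 3-cycles generate all even permutations. *)
Lemma amalgam_mem g :
  reflect (~~ odd_perm g /\ exists a b, [/\ a \in A, b \in B & agree_off g a b])
          (g \in A <*> B).
Proof.
(* A boolean form of the condition. Testing [X] before [Y] loses nothing, since their common point
   [p] lies in both orbits. *)
pose R := [set g : {perm T} | ~~ odd_perm g &
  [exists a in A, exists b in B, [forall z, if z \in X then (z \notin porb A) ==> (g z == a z)
    else if z \in Y then (z \notin porb B) ==> (g z == b z) else g z == z]]].
have RP h : reflect (~~ odd_perm h /\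
    exists a b, [/\ a \in A, b \in B & agree_off h a b]) (h \in R).
  rewrite inE; apply: (iffP andP) => -[evh].
    case/exists_inP=> a Aa /exists_inP[b Bb /forallP hab].
    split=> //; exists a, b; split=> //; split=> [z Xz Oz|]; [|split=> [z Yz Oz|z nXz nYz]].
    - by have := hab z; rewrite Xz Oz => /eqP.
    - have nXz : z \notin X by rewrite notinX // (contraNneq _ Oz) // => ->; apply: porb_p.
      by have := hab z; rewrite (negPf nXz) Yz Oz => /eqP.
    by have := hab z; rewrite (negPf nXz) (negPf nYz) => /eqP.
  case=> a [b [Aa Bb [hX [hY hO]]]]; split=> //; apply/exists_inP; exists a => //.
  apply/exists_inP; exists b => //; apply/forallP=> z.
  have [Xz | nXz] := ifPn; first by apply/implyP=> Oz; rewrite hX.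
  have [Yz | nYz] := ifPn; first by apply/implyP=> Oz; rewrite hY.
  by rewrite hO.
have gR : group_set R.
  apply/group_setP; split.
    apply/RP; rewrite odd_perm1; split=> //; exists 1, 1.
    by split; rewrite ?group1 //; have := agree_mul (group1 A) (group1 B); rewrite mulg1.
  move=> h h' /RP[evh [a [b [Aa Bb [hX [hY hO]]]]]] /RP[evh' [a' [b' [Aa' Bb' [hX' [hY' hO']]]]]].
  have [[ona _] [onb _]] := (evA Aa, evB Bb).
  apply/RP; rewrite odd_permM (negPf evh) (negPf evh'); split=> //.
  exists (a * a'), (b * b'); rewrite !groupM //; split=> //.
  split=> [z Xz Oz|]; [|split=> [z Yz Oz|z nXz nYz]].
  - by rewrite !permM hX // hX' ?porb_act // perm_closed.
  - by rewrite !permM hY // hY' ?porb_act // perm_closed.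
  by rewrite permM hO // hO'.
rewrite (_ : A <*> B = R); first exact: RP.
apply/eqP; rewrite eqEsubset; apply/andP; split.
  rewrite (gen_subG _ (Group gR)) /= subUset; apply/andP; split; apply/subsetP=> c Cc; apply/RP.
    have [_ evc] := evA Cc; split=> //; exists c, 1; split=> //.
    by have := agree_mul Cc (group1 B); rewrite mulg1.
  have [_ evc] := evB Cc; split=> //; exists 1, c; split=> //.
  by have := agree_mul (group1 A) Cc; rewrite mul1g.
apply/subsetP=> h /RP[evh [a [b [Aa Bb [hX [hY hO]]]]]].
have [[ona eva] [onb evb]] := (evA Aa, evB Bb).
have ABa : a \in A <*> B by apply: (subsetP (joing_subl _ _)).
have ABb : b \in A <*> B by apply: (subsetP (joing_subr _ _)).
suff: h * (a * b)^-1 \in A <*> B by rewrite groupMr // groupV groupM.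
have movedI (C : {group {perm T}}) : porb C != [set p] ->
    exists2 c, c \in C & c p != p.
  rewrite eqEsubset sub1set porb_p andbT => /subsetPn[z /orbitP[c Cc <-]].
  by rewrite inE; exists c.
have [[a0 Aa0 a0p] [b0 Bb0 b0p]] := (movedI A mvA, movedI B mvB).
apply: (@even_mem_star _ (A <*> B)%G p (porb A :\ p) (porb B :\ p) (a0 p) (b0 p)).
- by rewrite !inE a0p porb_act ?porb_p.
- by rewrite !inE b0p porb_act ?porb_p.
- by rewrite !inE eqxx.
- by rewrite !inE eqxx.
(* With [c] sending [p] to [u] and [d] sending [p] to [v], the required product is a commutator of
   [c] and [d]. *)
- move=> u v /setD1P[up /orbitP[c Ac cu]] /setD1P[vp /orbitP[d Bd dv]].
  rewrite /= !apermE in cu dv; rewrite -cu -dv in up vp *.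
  have [[onc _] [ond _]] := (evA Ac, evB Bd).
  have ABc : c \in A <*> B by apply: (subsetP (joing_subl _ _)).
  have ABd : d \in A <*> B by apply: (subsetP (joing_subr _ _)).
  by rewrite commutator_star // !groupM ?groupV.
- have [hXab [hYab hOab]] := agree_mul Aa Bb.
  apply/subsetP=> z; rewrite !inE; apply: contraNT.
  rewrite !negb_or !negb_and !negbK => /andP[zp /andP[]].
  rewrite (negPf zp) /= => OAz OBz; rewrite permM (can2_eq (permKV _) (permK _)).
  have [Xz | nXz] := boolP (z \in X); first by rewrite hX ?hXab.
  have [Yz | nYz] := boolP (z \in Y); first by rewrite hY ?hYab.
  by rewrite hO ?hOab.
by rewrite odd_permM odd_permV odd_permM (negPf evh) (negPf eva) (negPf evb).
Qed.

End TwoGroups.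

(* Either A is all of D, or its orbit of p avoids W, whose pointwise stabiliser
   in D will be trivial: then an element of A is determined off that orbit. *)
Definition anchored (W : {set T}) (D A : {group {perm T}}) :=
  A \subset D /\ (A :=: D \/ [disjoint porb A & W]).

(** In permutation group terms, [W] is a base of [D]. *)
Definition faithful_on (W : {set T}) (D : {group {perm T}}) :=
  {in D, forall d : {perm T}, {in W, forall z, d z = z} -> d = 1}.

(** * Recovering group elements from their values off an orbit *)

Section Anchored.

Variables (Z W : {set T}) (D : {group {perm T}}).
Hypotheses (WZ : W \subset Z) (fD : faithful_on W D).

Lemma faithful_eq : {in D &, forall d d' : {perm T}, {in W, forall z, d z = d' z} -> d = d'}.
Proof.
move=> d d' Dd Dd' dd'; apply/eqP; rewrite eq_mulgV1; apply/eqP.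
by apply: fD => [|z Wz]; rewrite ?groupM ?groupV // permM dd' // permK.
Qed.

(** If the orbit of [p] misses [W], then [a] and [a'] agree on [W] and hence coincide; otherwise [A]
    is all of [D]. *)
Lemma anchored_absorb A a a' : anchored W D A -> a \in D -> a' \in A ->
  {in Z, forall z, z \notin porb A -> a z = a' z} -> a \in A.
Proof.
move=> [/subsetP sAD [-> // | dW]] Da Aa' aa'.
rewrite (faithful_eq Da (sAD _ Aa')) // => z Wz.
by rewrite aa' ?(subsetP WZ) // (disjointFl dW).
Qed.

(** If one of [A], [A'] contains the other, the element of the smaller one serves as [c]. Otherwise
    neither is [D], both orbits miss [W], and [a = a']; the hypothesis on orbits then selects which
    agreement to use. *)
Lemma anchored_meet A A' a a' (g : T -> T) : anchored W D A -> anchored W D A' ->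
  porb (A :&: A')%G = porb A \/ porb (A :&: A')%G = porb A' ->
  a \in A -> a' \in A' ->
  {in Z, forall z, z \notin porb A -> g z = a z} ->
  {in Z, forall z, z \notin porb A' -> g z = a' z} ->
  exists2 c, c \in A :&: A' & {in Z, forall z, z \notin porb (A :&: A')%G -> g z = c z}.
Proof.
move=> [sAD anA] [sAD' anA'] oI Aa Aa' ga ga'.
have [sAA' | nsAA'] := boolP (A \subset A').
  have E : (A :&: A')%G = A by apply: val_inj; apply/setIidPl.
  by exists a; rewrite ?E // inE Aa (subsetP sAA').
have [sA'A | nsA'A] := boolP (A' \subset A).
  have E : (A :&: A')%G = A' by apply: val_inj; apply/setIidPr.
  by exists a'; rewrite ?E // inE Aa' (subsetP sA'A).
case: anA => [E | dA]; first by rewrite E sAD' in nsA'A.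
case: anA' => [E | dA']; first by rewrite E sAD in nsAA'.
have E : a = a'.
  apply: faithful_eq (subsetP sAD _ Aa) (subsetP sAD' _ Aa') _ => z Wz.
  by rewrite -ga -?ga' ?(subsetP WZ) // ?(disjointFl dA) ?(disjointFl dA').
exists a => [|z Zz]; first by rewrite inE Aa E.
by case: oI => ->; [apply: ga | rewrite E; apply: ga'].
Qed.

End Anchored.

(** * Intersections of amalgamated subgroups *)

Section Intersection.

Variables (D L : {group {perm T}}) (WX WY : {set T}).
Hypotheses (evD : even_on X D) (evL : even_on Y L).
Hypotheses (WXX : WX \subset X) (WYY : WY \subset Y).
Hypotheses (fD : faithful_on WX D) (fL : faithful_on WY L).

Lemma even_onS (S : {set T}) A B : A \subset B -> even_on S B -> even_on S A.
Proof. by move=> /subsetP sAB evB a /sAB/evB. Qed.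

(** The first pair factors [g] exactly as [a * b], the second only describes it off the orbits;
    anchoring of [A'] and [B'] turns this into [a \in A'] and [b \in B']. *)
Lemma amalgamI_mixed A B A' B' g :
  A \subset D -> B \subset L -> anchored WX D A' -> anchored WY L B' ->
  porb A = [set p] \/ porb B = [set p] -> porb A' != [set p] -> porb B' != [set p] ->
  g \in A <*> B -> g \in A' <*> B' -> g \in (A :&: A') <*> (B :&: B').
Proof.
move=> sAD sBL anA anB tr mvA mvB.
case/(amalgam_disjoint (even_onS sAD evD) (even_onS sBL evL) tr) => a [b [Aa Bb -> gX gY]].
have [[sAD' _] [sBL' _]] := (anA, anB).
case/(amalgam_mem (even_onS sAD' evD) (even_onS sBL' evL) mvA mvB).
move=> _ [a' [b' [Aa' Bb' [gX' [gY' _]]]]].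
have off C z : z \notin porb C -> z != p by apply: contraNneq => ->; apply: porb_p.
have Aa2 : a \in A'.
  apply: (anchored_absorb WXX fD anA (subsetP sAD _ Aa) Aa') => z Xz Oz.
  by rewrite -gX -?gX' // (off _ _ Oz).
have Bb2 : b \in B'.
  apply: (anchored_absorb WYY fL anB (subsetP sBL _ Bb) Bb') => z Yz Oz.
  by rewrite -gY -?gY' // (off _ _ Oz).
by rewrite groupM // mem_gen // !inE ?Aa ?Bb ?Aa2 ?Bb2 ?orbT.
Qed.

(** The cases depend on which of the two pairs have a member fixing [p]. If both do, the two
    factorisations agree off [p], hence everywhere. If neither does, [anchored_meet] supplies a
    common element on each side, and [g] is even. *)
Lemma amalgamI A B A' B' :
  anchored WX D A -> anchored WY L B -> anchored WX D A' -> anchored WY L B' ->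
  porb (A :&: A')%G = porb A \/ porb (A :&: A')%G = porb A' ->
  porb (B :&: B')%G = porb B \/ porb (B :&: B')%G = porb B' ->
  (A <*> B) :&: (A' <*> B') = (A :&: A') <*> (B :&: B').
Proof.
move=> anA anB anA' anB' oA oB.
apply/eqP; rewrite eqEsubset andbC subsetI !genS ?setUSS ?subsetIl ?subsetIr //=.
apply/subsetP=> g /setIP[gAB gAB'].
have [[sA _] [sB _]] := (anA, anB); have [[sA' _] [sB' _]] := (anA', anB').
have trP C C' : reflect (porb C = [set p] \/ porb C' = [set p])
    ((porb C == [set p]) || (porb C' == [set p])).
  by apply: (iffP orP) => -[] /eqP; [left|right|left|right].
have [tr | ] := boolP ((porb A == [set p]) || (porb B == [set p])).
  have [tr' | ] := boolP ((porb A' == [set p]) || (porb B' == [set p])); last first.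
    by rewrite negb_or => /andP[mA mB]; apply: amalgamI_mixed gAB gAB' => //; apply/trP.
  move: gAB; case/(amalgam_disjoint (even_onS sA evD) (even_onS sB evL) (trP _ _ tr)).
  move=> a [b [Aa Bb gE gX gY]].
  case/(amalgam_disjoint (even_onS sA' evD) (even_onS sB' evL) (trP _ _ tr')): gAB'.
  move=> a' [b' [Aa' Bb' _ gX' gY']].
  have [[ona _] [onb _]] := (even_onS sA evD Aa, even_onS sB evL Bb).
  have [[ona' _] [onb' _]] := (even_onS sA' evD Aa', even_onS sB' evL Bb').
  have Ea : a = a'.
    apply: (@eq_perm_off1 _ _ p) => z zp; have [Xz | nXz] := boolP (z \in X).
      by rewrite -gX // gX'.
    by rewrite !(out_perm _ nXz).
  have Eb : b = b'.
    apply: (@eq_perm_off1 _ _ p) => z zp; have [Yz | nYz] := boolP (z \in Y).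
      by rewrite -gY // gY'.
    by rewrite !(out_perm _ nYz).
  by rewrite gE groupM // mem_gen // !inE ?Aa ?Bb ?Ea ?Eb ?Aa' ?Bb' ?orbT.
rewrite negb_or => /andP[mA mB].
have [tr' | ] := boolP ((porb A' == [set p]) || (porb B' == [set p])).
  rewrite setIC [B :&: _]setIC.
  by apply: amalgamI_mixed gAB' gAB => //; apply/trP.
rewrite negb_or => /andP[mA' mB'].
move: gAB; case/(amalgam_mem (even_onS sA evD) (even_onS sB evL) mA mB).
move=> evg [a [b [Aa Bb [gX [gY gO]]]]].
case/(amalgam_mem (even_onS sA' evD) (even_onS sB' evL) mA' mB'): gAB'.
move=> _ [a' [b' [Aa' Bb' [gX' [gY' _]]]]].
have [c Ac gXc] := anchored_meet WXX fD anA anA' oA Aa Aa' gX gX'.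
have [d Bd gYd] := anchored_meet WYY fL anB anB' oB Bb Bb' gY gY'.
have sAI : A :&: A' \subset D by rewrite subIset ?sA.
have sBI : B :&: B' \subset L by rewrite subIset ?sB.
apply/(amalgam_mem (A := (A :&: A')%G) (B := (B :&: B')%G) (even_onS sAI evD) (even_onS sBI evL)).
- by case: oA => ->.
- by case: oB => ->.
by split=> //; exists c, d.
Qed.

End Intersection.
End Amalgam.

(** * The generators as maps on vertices *)

Definition follow (y : nat) (e : nat * nat) : nat :=
  if y == e.1 then e.2 else if y == e.2 then e.1 else y.

Definition edge_in (n : nat) (e : nat * nat) := (e.1 < n)%N && (e.2 < n)%N.

Lemma tpE n i j (Hi : (i < n)%N) (Hj : (j < n)%N) : tp n i j = tperm (Ordinal Hi) (Ordinal Hj).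
Proof. by rewrite /tp !insubT. Qed.

(** Permutations compose from left to right, so the product over the edges becomes a left fold,
    which computes on natural numbers. *)
Lemma rho_follow n lab (x : 'I_n) : all (edge_in n) (edges n lab) ->
  rho n lab x = foldl follow x (edges n lab) :> nat.
Proof.
rewrite /rho; elim: (edges n lab) x => [|[i j] es IH] x; first by rewrite big_nil perm1.
case/andP=> /andP[/= Hi Hj] /IH{}IH; rewrite big_cons permM IH (tpE Hi Hj) /=.
congr foldl; rewrite /follow /=.
by case: tpermP => [->|->|/eqP xi /eqP xj]; rewrite ?eqxx //=; [case: eqP | rewrite !ifN].
Qed.

Lemma odd_rho n lab :
  all (edge_in n) (edges n lab) -> all (fun e => e.1 != e.2) (edges n lab) ->
  odd_perm (rho n lab) = odd (size (edges n lab)).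
Proof.
rewrite /rho; elim: (edges n lab) => [|[i j] es IH]; first by rewrite big_nil odd_perm1.
move=> /andP[/andP[/= Hi Hj] es_in] /andP[/= ij es_neq].
by rewrite big_cons (tpE Hi Hj) odd_mul_tperm IH // -val_eqE /= ij addTb.
Qed.

(** Edge [s] joins [s - 1] to [s], so [y] is the lower end of edge [y + 1] and the upper end of edge
    [y]. These two have opposite parities, so at most one is selected. *)
Lemma foldl_follow_path n c m k y : (0 < m)%N ->
  foldl follow y [seq (vx n s, vx n s.+1) | s <- iota m k & odd s == c] =
  if (m <= y.+1 < m + k)%N && (odd y.+1 == c) then y.+1
  else if (m <= y < m + k)%N && (odd y == c) then y.-1 else y.
Proof.
elim: k m y => [|k IH] [//|m] y _ /=.
  by rewrite addn0 !ifN //; lia.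
case: ifP => mc /=; rewrite IH // /follow /vx /=; repeat case: ifP; lia.
Qed.

(** The common vertex [x_{n-10}] is numbered 0, and [a, ..., m] are numbered 1 to 10. *)
Definition right_edges (lab : nat) : seq (nat * nat) :=
  match lab with
  | 2 => [:: (0, 1); (8, 5); (9, 6); (10, 7)]
  | 3 => [:: (1, 2); (3, 5); (4, 6); (10, 7)]
  | 4 => [:: (2, 3); (6, 7); (8, 5); (9, 10)]
  | 5 => [:: (3, 4); (5, 6); (8, 9); (10, 7)]
  | _ => [::]
  end%N.

Definition right_act (lab i : nat) : nat := foldl follow i (right_edges lab).

Lemma edges_right o lab : lab \in [:: 2; 3; 4; 5]%N ->
  edges (o + 11) lab = [seq (o + e.1, o + e.2)%N | e <- right_edges lab].
Proof.
have E k : (k <= 11)%N -> (o + 11 - k = o + (11 - k))%N by move=> k11; rewrite addnBA.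
have E0 : ((o + 11 - 10).-1 = o + 0)%N by rewrite E // addn1 addn0.
by rewrite !inE => /or4P[]/eqP->; rewrite /= /vx /va /vb /vc /vd /ve /vf /vg /vh /vk /vm ?E0 ?E //.
Qed.

(** The path has [o + 1] vertices, an odd number, so [n - 10 - s] and [s] have opposite parities:
    label 1 takes the even [s], label 0 the odd ones. *)
Lemma edges_path o (c : bool) : ~~ odd o ->
  edges (o + 11) c = [seq (vx (o + 11) s, vx (o + 11) s.+1) | s <- iota 1 o & odd s == ~~ c].
Proof.
move=> evo; have -> : edges (o + 11) c = path_edges (o + 11) c by case: c.
rewrite /path_edges (_ : (o + 11 - 10 = o.+1)%N) /=; last by lia.
congr map; apply: eq_in_filter => s; rewrite mem_iota => /andP[_ so].
by rewrite oddB 1?ltnW // oddS (negPf evo) /=; case: (odd s); case: (c).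
Qed.

Section Vertices.

Variable o : nat.
Hypotheses (o4 : 4 %| o) (o_gt0 : (0 < o)%N).

Local Notation n := (o + 11)%N.
Local Notation rho := (rho n).

Lemma even_o : ~~ odd o.
Proof. by rewrite -dvdn2 (dvdn_trans _ o4). Qed.

Lemma edges_in lab : all (edge_in n) (edges n lab).
Proof.
have pathP (c : bool) : all (edge_in n) (edges n c).
  rewrite edges_path ?even_o //; apply/allP=> e /mapP[s].
  by rewrite mem_filter mem_iota => /andP[_ /andP[_ so]] ->; rewrite /edge_in /vx /=; lia.
have rightP : lab \in [:: 2; 3; 4; 5]%N -> all (edge_in n) (edges n lab).
  move=> lab_in; rewrite edges_right // all_map /edge_in; move: lab_in.
  by rewrite !inE => /or4P[]/eqP-> /=; rewrite !ltn_add2l.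
case: lab rightP => [|[|[|[|[|[|lab]]]]]] rightP //; try exact: rightP.
  exact: (pathP false).
exact: (pathP true).
Qed.

(** The truncated predecessor makes 0 a fixed point of label 1, and the test [x < o] makes [o] a
    fixed point of label 0. *)
Lemma rho_path (c : bool) (x : 'I_n) :
  rho c x = (if o < x then x : nat else if odd x == c then if x < o then x.+1 else x else x.-1)%N :> nat.
Proof.
rewrite rho_follow ?edges_in // edges_path ?even_o // foldl_follow_path //.
have := even_o; move: (x : nat) => y evo; case: c; repeat case: ifP; lia.
Qed.

Lemma rho_right lab (x : 'I_n) : lab \in [:: 2; 3; 4; 5]%N ->
  rho lab x = (if x < o then x : nat else o + right_act lab (x - o))%N :> nat.
Proof.
move=> lab_in; rewrite rho_follow ?edges_in // edges_right // /right_act.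
move: (x : nat) => {x}y; elim: (right_edges lab) y => [|e es IH] y /=.
  by case: ltnP => // /subnKC.
rewrite IH /follow /=; case: (ltnP y o) => yo.
  have /negPf-> : y != (o + e.1)%N by lia.
  have /negPf-> : y != (o + e.2)%N by lia.
  by rewrite yo.
have -> : (y == o + e.1)%N = (y - o == e.1)%N by lia.
have -> : (y == o + e.2)%N = (y - o == e.2)%N by lia.
case: (_ == e.1) => /=; first by rewrite ltnNge leq_addr addKn.
by case: (_ == e.2) => /=; rewrite ltnNge ?yo // leq_addr addKn.
Qed.

Lemma even_rho lab : ~~ odd_perm (rho lab).
Proof.
have pathP (c : bool) : ~~ odd_perm (rho c).
  rewrite odd_rho ?edges_in // edges_path ?even_o // ?all_map ?size_map.
    (* Four consecutive path edges contribute two to each label, so a multiple of four gives an even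
       count. *)
    rewrite size_filter; have [k ->] : exists k, o = (4 * k)%N by move/dvdnP: o4 => [k ->]; exists k; rewrite mulnC.
    elim: k => [|k IH] //; rewrite mulnS addnC iotaD count_cat oddD (negPf IH) /=.
    by case: (odd (0 + _)); case: (c).
  by apply/allP=> s; rewrite mem_filter mem_iota /vx /= => /andP[_ /andP[s1 _]]; lia.
have rightP : lab \in [:: 2; 3; 4; 5]%N -> ~~ odd_perm (rho lab).
  move=> lab_in; rewrite odd_rho ?edges_in // edges_right // ?all_map ?size_map.
    by move: lab_in; rewrite !inE => /or4P[]/eqP->.
  by move: lab_in; rewrite !inE => /or4P[]/eqP-> /=; rewrite !eqn_add2l.
case: lab rightP => [|[|[|[|[|[|lab]]]]]] rightP; try exact: rightP.
- exact: (pathP false).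
- exact: (pathP true).
by rewrite /Defs.rho /= big_nil odd_perm1.
Qed.

(** * Subgroups generated by lists of labels *)

Definition span (s : seq nat) : {group {perm 'I_n}} :=
  <<[set x in [seq rho i | i <- s]]>>%G.

Lemma mem_span i s : i \in s -> rho i \in span s.
Proof. by move=> si; rewrite mem_gen // inE map_f. Qed.

Lemma span_sub s t : {subset s <= t} -> span s \subset span t.
Proof.
move=> st; rewrite gen_subG; apply/subsetP=> x; rewrite inE => /mapP[i /st ti ->].
exact: mem_span.
Qed.

(** In a finite group every element is a product of generators without inverses. *)
Lemma span_ind s (P : {perm 'I_n} -> Prop) : P 1 ->
  (forall g j, j \in s -> P g -> P (g * rho j)) -> {in span s, forall g, P g}.
Proof.
move=> P1 PM g /gen_prodgP[k [c cs ->]].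
elim: k c cs => [|k IH] c cs; first by rewrite big_ord0.
rewrite big_ord_recr /=; have := cs ord_max; rewrite inE => /mapP[j sj ->].
by apply: PM => //; apply: IH => i; apply: cs.
Qed.

Lemma even_span s g : g \in span s -> ~~ odd_perm g.
Proof.
move: g; apply: span_ind => [|g j _ evg]; first by rewrite odd_perm1.
by rewrite odd_permM (negPf evg) (negPf (even_rho j)).
Qed.

Lemma span_on (S : {set 'I_n}) s g :
  {in s, forall j, perm_on S (rho j)} -> g \in span s -> perm_on S g.
Proof.
move=> onS; move: g; apply: span_ind => [|g j sj ong]; first exact: perm_on1.
by rewrite perm_onM // onS.
Qed.

Definition leftS : {set 'I_n} := [set x : 'I_n | (x <= o)%N].
Definition rightS : {set 'I_n} := [set x : 'I_n | (o <= x)%N].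
Definition vert i : 'I_n := rshift o (inord i : 'I_11).

Lemma vertE i : (i < 11)%N -> vert i = (o + i)%N :> nat.
Proof. by move=> i11; rewrite /= inordK. Qed.

Lemma vert_right i : vert i \in rightS.
Proof. by rewrite inE leq_addr. Qed.

Lemma rightP x : x \in rightS -> (x - o < 11)%N /\ x = vert (x - o).
Proof.
rewrite inE => ox; have x11 : (x - o < 11)%N by rewrite ltn_subLR.
by split=> //; apply: ord_inj; rewrite vertE // subnKC.
Qed.

Notation right_labels := [:: 2; 3; 4; 5]%N.

Lemma rho_right_on lab : lab \in right_labels -> perm_on rightS (rho lab).
Proof.
move=> lab_in; apply/subsetP=> x; rewrite !inE leqNgt; apply: contra => xo.
by rewrite -val_eqE /= rho_right // xo.
Qed.

Lemma rho_leftE c x : x \in leftS ->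
  rho (nat_of_bool c) x = (if odd x == c then if x < o then x.+1 else x else x.-1)%N :> nat.
Proof. by rewrite inE leqNgt => /negPf xo; rewrite rho_path xo. Qed.

Lemma rho_left_on (c : bool) : perm_on leftS (rho c).
Proof.
apply/subsetP=> x; rewrite !inE leqNgt; apply: contra => xo.
by rewrite -val_eqE /= rho_path // xo.
Qed.

Lemma right_span_on s g : {subset s <= right_labels} -> g \in span s -> perm_on rightS g.
Proof. by move=> sR; apply: span_on => j /sR; apply: rho_right_on. Qed.

(** * Computable codes for permutations of the right vertices *)

Definition code (g : {perm 'I_n}) : seq nat := [seq (g (vert i) - o)%N | i <- iota 0 11].

Lemma code1 : code 1 = iota 0 11.
Proof.
rewrite /code -[RHS]map_id; apply/eq_in_map=> i; rewrite mem_iota => /andP[_ i11].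
by rewrite perm1 vertE // addKn.
Qed.

Lemma nth_code g i : (i < 11)%N -> nth 0%N (code g) i = (g (vert i) - o)%N.
Proof. by move=> i11; rewrite (nth_map 0%N) ?size_iota // nth_iota. Qed.

Lemma rho_rightM g j x : perm_on rightS g -> j \in right_labels -> x \in rightS ->
  ((g * rho j)%g x - o = right_act j (g x - o))%N.
Proof.
move=> ong jR Yx; rewrite permM rho_right //; have: g x \in rightS by rewrite perm_closed.
by rewrite inE leqNgt => /negPf->; rewrite addKn.
Qed.

Lemma codeM g j : perm_on rightS g -> j \in right_labels ->
  code (g * rho j) = [seq right_act j k | k <- code g].
Proof.
move=> ong jR; rewrite /code -map_comp; apply: eq_map => i /=.
by rewrite rho_rightM ?vert_right.
Qed.

Lemma code_inj g h : perm_on rightS g -> perm_on rightS h -> code g = code h -> g = h.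
Proof.
move=> ong onh gh; apply/permP=> x.
have [Yx | nYx] := boolP (x \in rightS); last by rewrite !(out_perm _ nYx).
have [x11 xE] := rightP Yx.
have: g x \in rightS by rewrite perm_closed.
have: h x \in rightS by rewrite perm_closed.
rewrite !inE => ohx ogx; apply: val_inj; rewrite /= -(subnKC ohx) -(subnKC ogx).
by rewrite xE -!nth_code // gh.
Qed.

(** Breadth-first search by word length: only the last layer [fresh] is multiplied by generators,
    and codes already [seen] are dropped. *)
Fixpoint closure (s : seq nat) (k : nat) (seen fresh : seq (seq nat)) : seq (seq nat) :=
  if k is k'.+1 then
    let new := undup [seq e <- [seq map (right_act j) e | e <- fresh, j <- s] | e \notin seen] in
    closure s k' (seen ++ new) new
  else seen.

(* Eight rounds exhaust every subgroup generated by at most three of the four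
   involutions; the largest have order 60. *)
Definition codes s := closure s 8 [:: iota 0 11] [:: iota 0 11].

Arguments codes : simpl never.

(** This holds for any number of rounds; that the search ran long enough is certified by
    [codes_table_closed]. *)
Lemma codes_sound s e : {subset s <= right_labels} -> e \in codes s ->
  exists2 g, g \in span s & e = code g.
Proof.
move=> sR; rewrite /codes.
pose ok (es : seq (seq nat)) := forall e, e \in es -> exists2 g, g \in span s & e = code g.
suff: forall k seen fresh, ok seen -> ok fresh -> ok (closure s k seen fresh).
  by apply=> d; rewrite inE => /eqP->; exists 1; rewrite ?group1 ?code1.
elim=> [|k IH] seen fresh okS okF //=.
set new := undup _; have okN : ok new.
  move=> d; rewrite mem_undup mem_filter => /andP[_ /allpairsP[[d' j] /= [Fd' sj ->]]].
  have [g sg ->] := okF _ Fd'; exists (g * rho j); first by rewrite groupM ?mem_span.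
  by rewrite codeM ?sR // (right_span_on sR).
by apply: IH => // d; rewrite mem_cat => /orP[/okS | /okN].
Qed.

(** The lists are increasing, the form in which filtering by membership produces them. *)
Definition proper_labels : seq (seq nat) :=
  [:: [::]; [:: 2]; [:: 3]; [:: 4]; [:: 5]; [:: 2; 3]; [:: 2; 4]; [:: 2; 5]; [:: 3; 4];
      [:: 3; 5]; [:: 4; 5]; [:: 2; 3; 4]; [:: 2; 3; 5]; [:: 2; 4; 5]; [:: 3; 4; 5]]%N.

Definition codes_closed s (cs : seq (seq nat)) :=
  all (fun e => all (fun j => map (right_act j) e \in cs) s) cs.

Definition codes_meet (cs ct cst : seq (seq nat)) :=
  all (fun e => (e \in ct) ==> (e \in cst)) cs.

(** The first entry of a code is the image of the common vertex, so this lists the orbit of that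
    vertex. *)
Definition heads (cs : seq (seq nat)) := undup [seq nth 0%N e 0 | e <- cs].

Definition orbit_meet (hs ht hst : seq nat) :=
  all (fun i => i \in hst) hs || all (fun i => i \in hst) ht.

(** The vertices [d, f, g, k, m]. *)
Definition fixed_block := [:: 4; 6; 7; 9; 10]%N.

Notation labelled_codes := (seq nat * seq (seq nat))%type.

Definition codes_table : seq labelled_codes := [seq (s, codes s) | s <- proper_labels].

Lemma codes_table_closed : all (fun st : labelled_codes => (iota 0 11 \in st.2) && codes_closed st.1 st.2) codes_table.
Proof. by vm_compute. Qed.

Lemma codes_table_meet :
  all (fun st : labelled_codes => all (fun su : labelled_codes => codes_meet st.2 su.2 (codes [seq i <- st.1 | i \in su.1]))
    codes_table) codes_table.
Proof. by vm_compute. Qed.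

Lemma codes_table_heads :
  all (fun st : labelled_codes => all (fun su : labelled_codes => orbit_meet (heads st.2) (heads su.2)
     (heads (codes [seq i <- st.1 | i \in su.1])))
    codes_table) codes_table.
Proof. by vm_compute. Qed.

Lemma codes_table_block :
  all (fun st : labelled_codes => all (fun i => i \notin fixed_block) (heads st.2)) codes_table.
Proof. by vm_compute. Qed.

(** * The group on the eleven right vertices *)

Lemma rho_sq i : rho i * rho i = 1.
Proof.
have path (c : bool) : rho c * rho c = 1.
  apply/permP=> x; apply: ord_inj; rewrite permM perm1 !rho_path.
  have := even_o; move: (x : nat) => y evo; case: c; repeat case: ifP; lia.
have right : i \in right_labels -> rho i * rho i = 1.
  move=> iR; have on1 := perm_on1 rightS; have oni := rho_right_on iR.
  have ci : code (rho i) = [seq right_act i k | k <- iota 0 11].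
    by rewrite -[rho i]mul1g codeM // code1.
  apply: code_inj (perm_onM oni oni) on1 _; rewrite codeM // ci code1.
  by move: iR; rewrite !inE => /or4P[]/eqP->.
case: i right => [|[|[|[|[|[|i]]]]]] right; try exact: right.
- exact: (path false).
- exact: (path true).
by rewrite /Defs.rho /= big_nil mulg1.
Qed.

(** * Words in the right generators *)

Definition word w := \prod_(j <- w) rho j.
Definition word_code w := foldl (fun e j => [seq right_act j k | k <- e]) (iota 0 11) w.

Lemma code_word w : {subset w <= right_labels} -> code (word w) = word_code w.
Proof.
move=> wR; rewrite -[word w]mul1g /word_code -code1.
have gen g : perm_on rightS g ->
    code (g * word w) = foldl (fun e j => [seq right_act j k | k <- e]) (code g) w.
  elim: w g wR => [|j w IH] g wR ong; first by rewrite /word big_nil mulg1.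
  have jR : j \in right_labels by rewrite wR ?mem_head.
  rewrite /word big_cons mulgA IH /= ?codeM // => [i iw|]; first by rewrite wR // inE iw orbT.
  by rewrite perm_onM ?rho_right_on.
exact: gen (perm_on1 _).
Qed.

Lemma word_span w : word w \in span w.
Proof. by rewrite /word big_seq; apply: group_prod => j; apply: mem_span. Qed.

Lemma word_eqE w w' : all (fun j => j \in right_labels) w ->
  all (fun j => j \in right_labels) w' -> (word w == word w') = (word_code w == word_code w').
Proof.
move=> /allP wR /allP wR'; rewrite -!code_word //; apply/eqP/eqP=> [-> //|].
by apply: code_inj; [apply: right_span_on (word_span w) | apply: right_span_on (word_span w')].
Qed.

(** * From the computed tables to subgroups and orbits *)

Lemma proper_sub s : s \in proper_labels -> {subset s <= right_labels}.
Proof.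
have: all (all (fun i => i \in right_labels)) proper_labels by [].
by move=> /allP H /H /allP.
Qed.

Lemma codes_table_mem s : s \in proper_labels -> (s, codes s) \in codes_table.
Proof. exact: map_f. Qed.

(** A list that contains the identity and is stable under right multiplication by the generators
    exhausts the subgroup. *)
Lemma codes_complete s g : s \in proper_labels -> g \in span s -> code g \in codes s.
Proof.
move=> sP; have sR := proper_sub sP.
have /andP[id_in /allP cl] := allP codes_table_closed _ (codes_table_mem sP).
move=> sg.
suff: perm_on rightS g /\ code g \in codes s by case.
move: g sg; apply: span_ind => [|g j sj [ong cg]].
  by split; [apply: perm_on1 | rewrite code1].
have jR := sR _ sj; split; first by rewrite perm_onM ?rho_right_on.
by rewrite codeM // (allP (cl _ cg)).
Qed.

Lemma sub_filter_mem (s t : seq nat) : {subset s <= t} -> {subset s <= [seq i <- t | i \in s]}.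
Proof. by move=> st i si; rewrite mem_filter si st. Qed.

Notation right_sets := (right_labels :: proper_labels).

Lemma right_sub s : s \in right_sets -> {subset s <= right_labels}.
Proof. by rewrite in_cons => /predU1P[-> // | /proper_sub]. Qed.

(** If one list is full, the intersection is the other subgroup; for two proper lists the table
    decides, by injectivity of [code]. *)
Lemma right_meet s t : s \in right_sets -> t \in right_sets ->
  span s :&: span t = span [seq i <- s | i \in t].
Proof.
move=> sR tR; apply/eqP; rewrite eqEsubset subsetI !span_sub ?andbT; last first.
- by move=> i; rewrite mem_filter => /andP[].
- by move=> i; rewrite mem_filter => /andP[].
have [sF | sP] := predU1P sR.
  rewrite subIset // orbC span_sub // sF; exact: sub_filter_mem (right_sub tR).
have [tF | tP] := predU1P tR.
  rewrite subIset // span_sub // => i si; rewrite mem_filter si andbT tF.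
  exact: proper_sub sP _ si.
apply/subsetP=> g /setIP[sg tg]; set u := [seq i <- s | _].
have uR : {subset u <= right_labels}.
  by move=> i; rewrite mem_filter => /andP[_ /(proper_sub sP)].
have /allP/(_ _ (codes_table_mem tP)) := allP codes_table_meet _ (codes_table_mem sP).
move=> /allP/(_ _ (codes_complete sP sg))/=.
rewrite codes_complete //= => /(codes_sound uR)[h uh gh].
rewrite (code_inj _ _ gh) //; first exact: right_span_on (proper_sub sP) sg.
exact: right_span_on uR uh.
Qed.

Definition pt := vert 0.

Notation porb s := (orbit 'P (gval (span s)) pt).

Lemma mem_heads s e : e \in codes s -> nth 0%N e 0 \in heads (codes s).
Proof. by move=> se; rewrite mem_undup; apply/mapP; exists e. Qed.

Lemma headsP s i : {subset s <= right_labels} -> i \in heads (codes s) ->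
  exists2 g, g \in span s & i = (g pt - o)%N.
Proof.
move=> sR; rewrite mem_undup => /mapP[e /(codes_sound sR)[g sg ->] ->].
by exists g; rewrite ?nth_code.
Qed.

Lemma orbit_heads s u : {subset u <= right_labels} -> s \in proper_labels ->
  all (fun i => i \in heads (codes u)) (heads (codes s)) -> porb s \subset porb u.
Proof.
move=> uR sP /allP hsu; apply/subsetP=> x /orbitP[g sg <-]; rewrite /= apermE.
have := hsu _ (mem_heads (codes_complete sP sg)); rewrite nth_code // => /(headsP uR)[h uh gh].
have ong := right_span_on (proper_sub sP) sg; have onh := right_span_on uR uh.
apply/orbitP; exists h; rewrite //= apermE; apply: ord_inj.
have: g pt \in rightS by rewrite perm_closed ?vert_right.
have: h pt \in rightS by rewrite perm_closed ?vert_right.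
by rewrite !inE => /subnKC<- /subnKC<-; rewrite gh.
Qed.

Lemma porb_sub s u : {subset s <= u} -> porb s \subset porb u.
Proof.
move=> su; apply/subsetP=> x /orbitP[g sg <-]; apply/orbitP; exists g => //.
exact: subsetP (span_sub su) _ sg.
Qed.

Lemma right_orbit_meet s t : s \in right_sets -> t \in right_sets ->
  let u := [seq i <- s | i \in t] in porb u = porb s \/ porb u = porb t.
Proof.
move=> sR tR u.
have us : {subset u <= s} by move=> i; rewrite mem_filter => /andP[].
have ut : {subset u <= t} by move=> i; rewrite mem_filter => /andP[].
have uR : {subset u <= right_labels} by move=> i /us /(right_sub sR).
have [sF | sP] := predU1P sR.
  right; apply/eqP; rewrite eqEsubset !porb_sub // /u sF.
  exact: sub_filter_mem (right_sub tR).
have [tF | tP] := predU1P tR.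
  left; apply/eqP; rewrite eqEsubset !porb_sub // => i si; rewrite mem_filter si andbT tF.
  exact: proper_sub sP _ si.
have /allP/(_ _ (codes_table_mem tP)) := allP codes_table_heads _ (codes_table_mem sP).
move=> /orP[] /(orbit_heads uR) sub; [left | right]; apply/eqP.
  by rewrite eqEsubset sub // porb_sub.
by rewrite eqEsubset sub // porb_sub.
Qed.

(** * The invariant biplane and its fixed block *)

Definition block_pts : {set 'I_n} := [set x in [seq vert i | i <- fixed_block]].

Lemma block_sub : block_pts \subset rightS.
Proof. by apply/subsetP=> x; rewrite inE => /mapP[i _ ->]; apply: vert_right. Qed.

Lemma orbit_off_block s : s \in proper_labels -> [disjoint porb s & block_pts].
Proof.
move=> sP; apply/pred0P=> x; apply/negP=> /= /andP[/orbitP[g sg <-]] /=.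
rewrite apermE inE => /mapP[i iW gi].
have /allP := allP codes_table_block _ (codes_table_mem sP).
move=> /(_ _ (mem_heads (codes_complete sP sg))); rewrite nth_code // gi.
by move: iW; rewrite !inE => /or4P[/eqP->|/eqP->|/eqP->|/orP[]/eqP->]; rewrite vertE // addKn.
Qed.

(* The 11 blocks of the biplane on the 11 right vertices that is preserved by
   rho 2, ..., rho 5. *)
Definition blocks : seq (seq nat) :=
  [:: [:: 3; 5; 7; 8; 10]; [:: 0; 1; 5; 7; 9]; [:: 4; 6; 7; 9; 10]; [:: 0; 1; 6; 8; 10];
      [:: 0; 2; 3; 9; 10]; [:: 2; 5; 6; 8; 9]; [:: 1; 2; 4; 5; 10]; [:: 1; 2; 3; 6; 7];
      [:: 0; 3; 4; 5; 6]; [:: 0; 2; 4; 7; 8]; [:: 1; 3; 4; 8; 9]]%N.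

Lemma right_act_blocks :
  all (fun j => all (fun B => has (fun B' => all (fun i => right_act j i \in B') B) blocks) blocks)
    right_labels.
Proof. by vm_compute. Qed.

Lemma span_blocks g B : g \in span right_labels -> B \in blocks ->
  exists2 B', B' \in blocks & {in B, forall i, (g (vert i) - o)%N \in B'}.
Proof.
move=> sg BB.
suff: perm_on rightS g /\
  exists2 B', B' \in blocks & {in B, forall i, (g (vert i) - o)%N \in B'} by case.
move: g sg; apply: span_ind => [|g j jR [ong [B' BB' gB]]].
  split; first exact: perm_on1.
  exists B => // i Bi; have i11 : (i < 11)%N.
    have: all (all (fun i => (i < 11)%N)) blocks by [].
    by move=> /allP/(_ _ BB)/allP/(_ _ Bi).
  by rewrite perm1 vertE // addKn.
split; first by rewrite perm_onM ?rho_right_on.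
have /hasP[B2 BB2 /allP jB] := allP (allP right_act_blocks j jR) _ BB'.
by exists B2 => // i /gB /jB; rewrite rho_rightM ?vert_right.
Qed.

(* Two blocks meet in two points and two points lie in two blocks, so a block other
   than fixed_block is determined by its trace on fixed_block; these blocks separate the
   remaining points. *)
Lemma blocks_separate :
  all (fun i => all (fun k => [|| i == k, i \in fixed_block, k \in fixed_block |
    has (fun B => (i \in B) && all (fun B' =>
      all (fun l => (l \in fixed_block) ==> (l \in B')) B ==> (k \notin B')) blocks) blocks])
    (iota 0 11)) (iota 0 11).
Proof. by vm_compute. Qed.

(** Suppose [d] sends [i] to [k], distinct and both outside the fixed block. Some block [B] through
    [i] has the property that any block containing the trace of [B] on the fixed block avoids [k].
    The image of [B] lies in such a block, since [d] fixes the trace, yet it contains [k]. *)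
Lemma right_faithful : faithful_on block_pts (span right_labels).
Proof.
move=> d Ld fixd; have ond := right_span_on (fun _ => id) Ld.
have fixW i : i \in fixed_block -> d (vert i) = vert i.
  by move=> Wi; apply: fixd; rewrite inE map_f.
apply/permP=> x; rewrite perm1.
have [Yx | nYx] := boolP (x \in rightS); last by rewrite (out_perm ond).
have [i11 xE] := rightP Yx; set i := (x - o)%N in i11 xE.
have Ydx : d x \in rightS by rewrite perm_closed.
have [k11 dxE] := rightP Ydx; set k := (d x - o)%N in k11 dxE.
have mem11 l : (l < 11)%N -> l \in iota 0 11 by rewrite mem_iota.
have /or4P[/eqP ik | Wi | Wk | /hasP[B BB /andP[Bi /allP sepB]]] :=
  allP (allP blocks_separate i (mem11 _ i11)) k (mem11 _ k11).
- by rewrite dxE -ik.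
- by rewrite xE fixW.
- by apply: (@perm_inj _ d); rewrite {1}dxE fixW.
have [B' BB' dB] := span_blocks Ld BB.
have /implyP/(_ _)/negP[] := sepB _ BB'; last by rewrite /k xE dB.
apply/allP=> l Bl; apply/implyP=> Wl; have := dB l Bl; rewrite fixW // vertE ?addKn //.
by move: Wl; rewrite !inE => /or4P[/eqP->|/eqP->|/eqP->|/orP[]/eqP->].
Qed.

(* The word number i sends the common vertex to vert i. *)
Definition route : seq (seq nat) :=
  [:: [::]; [:: 2]; [:: 2; 3]; [:: 2; 3; 4]; [:: 2; 3; 4; 5]; [:: 2; 3; 4; 3];
      [:: 2; 3; 4; 3; 5]; [:: 2; 3; 4; 3; 5; 4]; [:: 2; 3; 4; 3; 4];
      [:: 2; 3; 4; 3; 4; 5]; [:: 2; 3; 4; 3; 4; 5; 4]]%N.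

Lemma right_transitive : porb right_labels = rightS.
Proof.
apply/eqP; rewrite eqEsubset; apply/andP; split; apply/subsetP=> x.
  case/orbitP=> g Lg <-; rewrite /= apermE.
  by rewrite (perm_closed _ (right_span_on _ Lg)) ?vert_right.
move=> Yx; have [i11 xE] := rightP Yx; set i := (x - o)%N in i11 xE.
have routeE : all (fun i => all (fun j => j \in right_labels) (nth [::] route i) &&
  (nth 0%N (word_code (nth [::] route i)) 0 == i)) (iota 0 11) by vm_compute.
have := allP routeE i; rewrite mem_iota i11 => /(_ isT).
move: (nth [::] route i) => w /andP[/allP wR /eqP wi].
have Lw : word w \in span right_labels.
  by apply: subsetP (word_span w); apply: span_sub.
suff <- : word w pt = x by apply: (mem_orbit 'P pt Lw).
have: word w pt \in rightS by rewrite (perm_closed _ (right_span_on _ Lw)) ?vert_right.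
have := nth_code (word w) (isT : 0 < 11)%N; rewrite (code_word wR) wi => iE.
by case/rightP=> _ ->; rewrite [RHS]xE iE.
Qed.

(** * The dihedral group on the path *)

Definition left0 : 'I_n := Ordinal (ltn_addl o (isT : 0 < 11)%N).
Definition left1 : 'I_n := Ordinal (ltn_addl o (isT : 1 < 11)%N).

Lemma o_ge4 : (3 < o)%N.
Proof. exact: dvdn_leq. Qed.

Lemma left0_in : left0 \in leftS. Proof. by rewrite inE. Qed.
Lemma left1_in : left1 \in leftS. Proof. by rewrite inE. Qed.

Lemma ptE : pt = o :> nat. Proof. by rewrite vertE // addn0. Qed.
Lemma pt_left : pt \in leftS. Proof. by rewrite inE ptE. Qed.
Lemma pt_right : pt \in rightS. Proof. exact: vert_right. Qed.

Lemma left_right x : x \in leftS -> x \in rightS -> x = pt.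
Proof. by rewrite !inE => x1 x2; apply: ord_inj; rewrite ptE; apply/eqP; rewrite eqn_leq x1. Qed.

Notation left_labels := [:: 0; 1]%N.

Lemma left_span_on s g : {subset s <= left_labels} -> g \in span s -> perm_on leftS g.
Proof.
move=> sL; apply: span_on => j /sL; rewrite !inE => /orP[]/eqP->.
  exact: (rho_left_on false).
exact: (rho_left_on true).
Qed.

Lemma left_orbit0 x : x \in leftS -> x \in orbit 'P (span left_labels) left0.
Proof.
move: {2}(nat_of_ord x) (erefl (nat_of_ord x)) => k; elim: k x => [|k IH] x xk Xx.
  by have -> : x = left0 by [apply: ord_inj]; apply: orbit_refl.
have ko : (k < o)%N by rewrite inE xk in Xx.
have kn : (k < n)%N by rewrite ltn_addr.
have Xy : Ordinal kn \in leftS by rewrite inE ltnW.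
(* The path edge from [k] to [k + 1] carries label 1 exactly when [k] is odd. *)
have -> : x = rho (odd k) (Ordinal kn).
  by apply: ord_inj; rewrite rho_leftE //= eqxx ko.
have /orbitP[g Lg gy] := IH (Ordinal kn) erefl Xy; apply/orbitP.
exists (g * rho (odd k)); last by rewrite /= apermE permM -gy.
by rewrite groupM // mem_span; case: (odd k).
Qed.

Lemma left_transitive : porb left_labels = leftS.
Proof.
apply/eqP; rewrite eqEsubset; apply/andP; split; apply/subsetP=> x.
  case/orbitP=> g Lg <-; rewrite /= apermE.
  by rewrite (perm_closed _ (left_span_on _ Lg)) ?pt_left.
by move/left_orbit0; rewrite -(orbit_eqP (left_orbit0 pt_left)).
Qed.

Definition rot := rho 0 * rho 1.

Lemma rho1_left0 : rho 1 left0 = left0.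
Proof. by apply: ord_inj; rewrite (rho_leftE true) ?left0_in. Qed.

Lemma rot_span : <[rot]> \subset span left_labels.
Proof. by rewrite cycle_subG groupM ?mem_span. Qed.

(** The reflection [rho 1] inverts the rotation [rot], so it normalises [<[rot]>], and the dihedral
    group is the product of the two cyclic groups. *)
Lemma left_span_mul d : d \in span left_labels ->
  exists r k, [/\ r = 1 \/ r = rho 1, k \in <[rot]> & d = r * k].
Proof.
have rho_inv i : (rho i)^-1 = rho i by apply/eqP; rewrite eq_invg_mul rho_sq.
have nR : <[rho 1]> \subset 'N(<[rot]>).
  rewrite norms_cycle /rot /conjg rho_inv -!mulgA rho_sq mulg1.
  have -> : rho 1 * rho 0 = rot^-1 by rewrite invMg !rho_inv.
  by rewrite groupV cycle_id.
have sD : span left_labels \subset <[rho 1]> * <[rot]>.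
  rewrite -(norm_joinEl nR) gen_subG; apply/subsetP=> x; rewrite !inE => /orP[]/eqP->.
    rewrite (_ : rho 0 = rot * rho 1); last by rewrite -mulgA rho_sq mulg1.
    by rewrite groupM // (subsetP (joing_subr _ _) _ (cycle_id _), subsetP (joing_subl _ _) _ (cycle_id _)).
  exact: subsetP (joing_subl _ _) _ (cycle_id _).
case/(subsetP sD)/mulsgP=> r k /cycleP[i ->] Ck ->; exists (rho 1 ^+ i), k; split=> //.
rewrite -(odd_double_half i) expgD -mul2n expgM expgS expg1 rho_sq expg1n mulg1.
by case: (odd i); [right; rewrite expg1 | left].
Qed.

(** Since [rho 1] fixes [left0], rotations alone carry [left0] to every path vertex; as they
    commute, one that fixes [left0] fixes the whole path. *)
Lemma rot_free k : k \in <[rot]> -> k left0 = left0 -> k = 1.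
Proof.
move=> Ck k0; have Dk := subsetP rot_span _ Ck.
apply/permP=> x; rewrite perm1; have [Xx | nXx] := boolP (x \in leftS); last first.
  by rewrite (out_perm (left_span_on _ Dk)).
have /orbitP[d Ld <-] := left_orbit0 Xx; rewrite /= apermE.
have [r [k' [rE Ck' ->]]] := left_span_mul Ld.
have r0 : r left0 = left0 by case: rE => ->; rewrite ?perm1 ?rho1_left0.
have := centsP (cycle_abelian rot) _ Ck _ Ck' => cc.
by rewrite permM r0 -permM -cc permM k0.
Qed.

(** The rotations act regularly on the [o + 1] vertices of the path. *)
Lemma order_rot : #[rot] = o.+1.
Proof.
have -> : o.+1 = #|leftS|.
  have le_n : (o.+1 <= n)%N by rewrite -addn1 leq_add2l.
  have inj : injective (widen_ord le_n) by move=> i j [] /ord_inj.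
  rewrite -[LHS]card_ord -(card_imset _ inj); apply: eq_card => x.
  rewrite inE -ltnS; apply/imsetP/idP=> [[i _ ->] | xo]; first exact: (ltn_ord i).
  by exists (Ordinal xo) => //; apply: ord_inj.
have -> : leftS = [set (k : {perm _}) left0 | k in <[rot]>]; last first.
  rewrite card_in_imset // => k k' Ck Ck' kk'; apply/eqP; rewrite eq_mulgV1; apply/eqP.
  by apply: rot_free; rewrite ?groupM ?groupV // permM kk' permK.
apply/setP=> x; apply/idP/imsetP=> [Xx | [k Ck ->]].
  have /orbitP[d Ld <-] := left_orbit0 Xx; have [r [k [rE Ck ->]]] := left_span_mul Ld.
  by exists k => //; rewrite /= apermE permM; case: rE => ->; rewrite ?perm1 ?rho1_left0.
by rewrite (perm_closed _ (left_span_on _ (subsetP rot_span _ Ck))) ?left0_in.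
Qed.

(** Fixing [x_1] kills the rotation factor, and the remaining reflection [rho 1] moves [x_2] to
    [x_3]. *)
Lemma left_faithful : faithful_on [set left0; left1] (span left_labels).
Proof.
move=> d Ld fixd; have [r [k [rE Ck dE]]] := left_span_mul Ld.
have r0 : r left0 = left0 by case: rE => ->; rewrite ?perm1 ?rho1_left0.
have k1 : k = 1.
  by apply: rot_free => //; rewrite -{2}(fixd left0) ?set21 // dE permM r0.
rewrite dE k1 mulg1; case: rE => // rE; have := fixd left1 (set22 _ _).
rewrite dE k1 mulg1 rE => /(congr1 (@nat_of_ord _)).
by rewrite (rho_leftE true) ?left1_in //= (ltn_trans _ o_ge4).
Qed.

(** * Parabolic subgroups of the dihedral group *)

Lemma span1 i g : g \in span [:: i] -> g = 1 \/ g = rho i.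
Proof.
move: g; apply: span_ind => [|g j]; first by left.
by rewrite inE => /eqP-> [] ->; [right; rewrite mul1g | left; rewrite rho_sq].
Qed.

Lemma rho_pt c : rho (nat_of_bool c) pt = (if c then o.-1 else o) :> nat.
Proof. by rewrite rho_leftE ?pt_left // ptE (negPf even_o) ltnn; case: c. Qed.

Definition left_sets : seq (seq nat) := [:: [::]; [:: 0]; [:: 1]; [:: 0; 1]]%N.

Lemma left_sets_comparable s t : s \in left_sets -> t \in left_sets ->
  [\/ {subset s <= t}, {subset t <= s}, s = [:: 0%N] /\ t = [:: 1%N]
    | s = [:: 1%N] /\ t = [:: 0%N]].
Proof.
have sub u v : all (fun i => i \in v) u -> {subset u <= v :> seq nat} by move/allP.
rewrite !inE => /or4P[]/eqP-> /or4P[]/eqP->;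
  by [constructor 1; apply: sub | constructor 2; apply: sub | constructor 3 | constructor 4].
Qed.

Lemma span01_trivial g : g \in span [:: 0%N] -> g \in span [:: 1%N] -> g = 1.
Proof.
have rho0_left0 : rho 0 left0 != left0.
  by apply/eqP=> /(congr1 (@nat_of_ord _)); rewrite (rho_leftE false) ?left0_in //= o_gt0.
case/span1=> -> // /span1[// | eq01].
by move: rho0_left0; rewrite eq01 rho1_left0 eqxx.
Qed.

Lemma left_meet s t : s \in left_sets -> t \in left_sets ->
  span s :&: span t = span [seq i <- s | i \in t].
Proof.
move=> sL tL; apply/eqP; rewrite eqEsubset subsetI !span_sub ?andbT; last first.
- by move=> i; rewrite mem_filter => /andP[].
- by move=> i; rewrite mem_filter => /andP[].
have [st | ts | [-> ->] | [-> ->]] := left_sets_comparable sL tL.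
- by rewrite subIset // span_sub // => i si; rewrite mem_filter si st.
- by rewrite subIset // orbC span_sub // => i ti; rewrite mem_filter ti ts.
- by apply/subsetP=> g /setIP[g0 g1]; rewrite (span01_trivial g0 g1) group1.
by apply/subsetP=> g /setIP[g1 g0]; rewrite (span01_trivial g0 g1) group1.
Qed.

(** The only incomparable lists are those of 0 and of 1. As [rho 0] fixes [pt], its orbit is a
    single point, contained in every other orbit. *)
Lemma left_orbit_meet s t : s \in left_sets -> t \in left_sets ->
  let u := [seq i <- s | i \in t] in porb u = porb s \/ porb u = porb t.
Proof.
move=> sL tL u.
have us : {subset u <= s} by move=> i; rewrite mem_filter => /andP[].
have ut : {subset u <= t} by move=> i; rewrite mem_filter => /andP[].
have orb0 v : porb [:: 0%N] \subset porb v.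
  apply/subsetP=> x /orbitP[g /span1 g0 <-]; rewrite /= apermE.
  have -> : g pt = pt.
    by case: g0 => ->; rewrite ?perm1 //; apply: ord_inj; rewrite (rho_pt false) ptE.
  exact: orbit_refl.
have [st | ts | [E _] | [_ E]] := left_sets_comparable sL tL.
- by left; apply/eqP; rewrite eqEsubset !porb_sub // => i si; rewrite mem_filter si st.
- by right; apply/eqP; rewrite eqEsubset !porb_sub // => i ti; rewrite mem_filter ti ts.
- by left; apply/eqP; rewrite eqEsubset porb_sub // E orb0.
by right; apply/eqP; rewrite eqEsubset porb_sub // E orb0.
Qed.

(** With at most one reflection, the orbit of [pt] lies in [{o - 1, o}], far from 0 and 1 because
    [o] is at least 4. *)
Lemma orbit_off_left01 s : s \in [:: [::]; [:: 0]; [:: 1]]%N ->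
  [disjoint porb s & [set left0; left1]].
Proof.
move=> sL; apply/pred0P=> x; apply/negP=> /= /andP[/orbitP[g sg <-]] /=.
rewrite apermE => g01; have: (g pt <= 1)%N.
  by case/set2P: g01 => ->.
have o4' := o_ge4; apply/negP; rewrite -ltnNge.
have [c gc] : exists c : bool, g \in span [:: nat_of_bool c].
  move: sL; rewrite !inE => /or3P[]/eqP sE; rewrite sE in sg.
  - by exists false; apply: subsetP sg; apply: span_sub.
  - by exists false.
  - by exists true.
by case: (span1 gc) => ->; rewrite ?perm1 ?ptE ?rho_pt //; [lia | case: c {gc}; lia].
Qed.

(** * Intersection property and orders *)

Definition sel (J : {set 'I_6}) (s : seq nat) := [seq i <- s | inord i \in J].

Lemma sel_meet J K s : sel (J :&: K) s = [seq i <- sel J s | i \in sel K s].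
Proof.
rewrite /sel -filter_predI; apply: eq_in_filter => i si /=.
by rewrite inE mem_filter si andbT andbC.
Qed.

Lemma sel_left J : sel J left_labels \in left_sets.
Proof. by rewrite /sel /=; case: (_ \in J); case: (_ \in J). Qed.

Lemma sel_right J : sel J right_labels \in right_sets.
Proof. by rewrite /sel /=; do 4?case: (_ \in J). Qed.

(** Each label belongs to one of the two sides, which brings a standard subgroup into the form
    treated by [amalgamI]. *)
Lemma gens_gen (J : {set 'I_6}) :
  <<gens_of rho J>> = span (sel J left_labels) <*> span (sel J right_labels).
Proof.
apply/eqP; rewrite eqEsubset; apply/andP; split.
  rewrite gen_subG; apply/subsetP=> x /imsetP[j Jj ->].
  have mem_sel s : nat_of_ord j \in s -> rho j \in span (sel J s).
    by move=> sj; rewrite mem_span // mem_filter inord_val Jj.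
  have: nat_of_ord j \in left_labels ++ right_labels by case: j {Jj mem_sel} => [[|[|[|[|[|[|]]]]]]].
  rewrite mem_cat => /orP[]/mem_sel; apply: subsetP; [exact: joing_subl | exact: joing_subr].
have selJ s : {subset s <= iota 0 6} -> span (sel J s) \subset <<gens_of rho J>>.
  move=> s6; rewrite gen_subG; apply/subsetP=> x; rewrite inE => /mapP[i].
  rewrite mem_filter => /andP[Ji /s6]; rewrite mem_iota => /andP[_ i6] ->.
  by rewrite mem_gen //; apply/imsetP; exists (inord i); rewrite ?inordK.
by rewrite join_subG !selJ //; apply/allP.
Qed.

Lemma left_even_on : even_on leftS (span left_labels).
Proof. by move=> g Lg; split; [apply: left_span_on Lg | apply: even_span Lg]. Qed.

Lemma right_even_on : even_on rightS (span right_labels).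
Proof. by move=> g Lg; split; [apply: right_span_on Lg | apply: even_span Lg]. Qed.

Lemma left_anchored s : s \in left_sets ->
  anchored pt [set left0; left1] (span left_labels) (span s).
Proof.
move=> sL; split.
  have /allP/(_ s sL)/allP sub : all (all (fun i => i \in left_labels)) left_sets by [].
  exact: span_sub.
move: sL; rewrite (_ : left_sets = [:: [::]; [:: 0]; [:: 1]]%N ++ [:: left_labels]) //.
by rewrite mem_cat mem_seq1 => /orP[/orbit_off_left01 | /eqP->]; [right | left].
Qed.

Lemma right_anchored s : s \in right_sets -> anchored pt block_pts (span right_labels) (span s).
Proof.
move=> sR; split; first exact: span_sub (right_sub sR).
by case/predU1P: sR => [-> | /orbit_off_block]; [left | right].
Qed.

Lemma rho_intersection : @intersection_property {perm 'I_n} 6 rho.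
Proof.
move=> J K; rewrite !gens_gen !sel_meet.
have [sL tL] := (sel_left J, sel_left K); have [sR tR] := (sel_right J, sel_right K).
rewrite -(left_meet sL tL) -(right_meet sR tR).
have sW : [set left0; left1] \subset leftS.
  by apply/subsetP=> x /set2P[]->; [apply: left0_in | apply: left1_in].
apply: (amalgamI pt_left pt_right left_right left_even_on right_even_on
  sW block_sub left_faithful right_faithful).
- exact: left_anchored.
- exact: right_anchored.
- exact: left_anchored.
- exact: right_anchored.
- by rewrite /= left_meet //; apply: left_orbit_meet.
by rewrite /= right_meet //; apply: right_orbit_meet.
Qed.

(** Both sides are transitive on their supports, so the two orbits cover all vertices and evenness
    is the only condition left. *)
Lemma rho_gen_Alt : <<gens_of rho [set: 'I_6]>> = 'Alt_('I_n).
Proof.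
have selT s : sel [set: 'I_6] s = s by rewrite /sel -[RHS]filter_predT; apply: eq_filter => i; rewrite inE.
rewrite gens_gen !selT; apply/setP=> g; rewrite Alt_even.
have mv x (S : {set 'I_n}) : x \in S -> x != pt -> S != [set pt].
  by move=> Sx xpt; apply: contraNneq xpt => SE; rewrite SE inE in Sx.
have lt_o x : (x < o)%N -> forall z : 'I_n, z = x :> nat -> z != pt.
  by move=> xo z zx; apply: contraTneq xo => zE; rewrite -zx zE ptE ltnn.
apply/(amalgam_mem pt_left pt_right left_right left_even_on right_even_on)/idP.
- by rewrite left_transitive; apply: (mv left0); rewrite ?left0_in // (lt_o 0%N).
- rewrite right_transitive; apply: (mv (vert 1)); first exact: vert_right.
  by apply/eqP=> /(congr1 (@nat_of_ord _)); rewrite vertE // ptE; lia.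
- by case.
move=> evg; split=> //; exists 1, 1; split; rewrite ?group1 //.
split=> [z Xz|]; first by rewrite left_transitive Xz.
split=> [z Yz|z nXz nYz]; first by rewrite right_transitive Yz.
by rewrite !inE in nXz nYz; lia.
Qed.

(** * The string relations *)

Lemma perm_onD1 (S : {set 'I_n}) g x : perm_on S g -> g x = x -> perm_on (S :\ x) g.
Proof.
move=> ong gx; apply/subsetP=> y; rewrite !inE => gy.
by rewrite (subsetP ong) ?andbT //; apply: contra gy => /eqP->; rewrite gx.
Qed.

Lemma rho_right_pt j : j \in [:: 3; 4; 5]%N -> rho j pt = pt.
Proof.
move=> j3; apply: ord_inj; rewrite rho_right; last by rewrite inE j3 orbT.
rewrite ptE ltnn subnn; move: j3.
by rewrite !inE => /or3P[]/eqP->; rewrite addn0.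
Qed.

(** Label 0 fixes [pt], and so do labels 3, 4 and 5, so a left label and a right label at distance
    at least two have disjoint supports. The pairs among 2 to 5 are compared by their codes. *)
Lemma rho_commute i j : (i.+2 <= j)%N -> (j < 6)%N -> commute (rho i) (rho j).
Proof.
have left0_on : perm_on (leftS :\ pt) (rho 0).
  by apply: perm_onD1 (rho_left_on false) _; apply: ord_inj; rewrite (rho_pt false) ptE.
have right_on k : k \in [:: 3; 4; 5]%N -> perm_on (rightS :\ pt) (rho k).
  move=> k3; apply: perm_onD1 (rho_right_pt k3).
  by apply: rho_right_on; rewrite inE k3 orbT.
have dis0 : [disjoint leftS :\ pt & rightS].
  apply/pred0P=> x; apply/negP=> /= /andP[/setD1P[xp Xx] Yx].
  by rewrite (left_right Xx Yx) eqxx in xp.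
have dis1 : [disjoint leftS & rightS :\ pt].
  apply/pred0P=> x; apply/negP=> /= /andP[Xx /setD1P[xp Yx]].
  by rewrite (left_right Xx Yx) eqxx in xp.
have word2 k l : word [:: k; l] = rho k * rho l by rewrite /word !big_cons big_nil mulg1.
move=> ij j6.
have [jR | ] := boolP (j \in right_labels); last first.
  by rewrite !inE; lia.
case: i ij => [|[|i]] ij.
- exact: perm_onC left0_on (rho_right_on jR) dis0.
- apply: perm_onC (rho_left_on true) (right_on j _) dis1.
  by rewrite !inE; lia.
have: (i.+2, j) \in [:: (2, 4); (2, 5); (3, 5)]%N by rewrite !inE !xpair_eqE; lia.
by rewrite /commute -!word2 => ijE; apply/eqP; rewrite word_eqE; move: ijE;
  rewrite !inE !xpair_eqE => /or3P[]/andP[/eqP-> /eqP->].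
Qed.

Lemma rho_neq1 i : (i < 6)%N -> rho i != 1.
Proof.
have path (c : bool) : rho c != 1.
  apply/eqP=> /permP/(_ left1)/(congr1 (@nat_of_ord _)).
  rewrite rho_leftE ?left1_in // perm1 /=; have := o_ge4; case: c => /= o4'; rewrite ?ifT //.
  exact: ltn_trans o4'.
have word1 k : word [:: k] = rho k by rewrite /word big_cons big_nil mulg1.
have word0 : word [::] = 1 by rewrite /word big_nil.
case: i => [|[|i]] i6; [exact: (path false) | exact: (path true) |].
by rewrite -word1 -word0; case: i i6 => [|[|[|[|]]]] // _; rewrite word_eqE.
Qed.

Lemma rho_sggi : @sggi {perm 'I_n} 6 rho.
Proof.
split=> [i i6 | i j i6 j6 ij]; first by apply: nt_prime_order; rewrite ?rho_neq1 // expgS expg1 rho_sq.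
have cij : commute (rho i) (rho j).
  by case/orP: ij => ij; [|apply: commute_sym]; apply: rho_commute.
by rewrite expgMn // !expgS !expg0 !mulg1 !rho_sq mulg1.
Qed.

(** * The Schläfli type *)

Lemma wordX i j k : word (flatten (nseq k [:: i; j])) = (rho i * rho j) ^+ k.
Proof.
elim: k => [|k IH]; first by rewrite /word big_nil.
by rewrite /word /= !big_cons mulgA expgS -IH.
Qed.

(** For prime [k] it suffices that the product is nontrivial with trivial [k]-th power, and both are
    read off codes. *)
Lemma order_right i j k : i \in right_labels -> j \in right_labels -> prime k ->
  word_code (flatten (nseq k [:: i; j])) = iota 0 11 -> word_code [:: i; j] != iota 0 11 ->
  #[rho i * rho j] = k.
Proof.
move=> iR jR kp ijk ij1.
have ijR m : all (fun l => l \in right_labels) (flatten (nseq m [:: i; j])).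
  by elim: m => //= m ->; rewrite iR jR.
have word0 : word [::] = 1 by rewrite /word big_nil.
apply: nt_prime_order => //.
  by apply/eqP; rewrite -wordX -word0 word_eqE // ijk.
by rewrite -[X in X != _]expg1 -wordX -word0 word_eqE // (ijR 1%N).
Qed.

(** The square of the inverse [y] is a 3-cycle, while its cube still swaps [x_2] and [x_3]. *)
Lemma order_rho12 : #[rho 1 * rho 2] = 6.
Proof.
have rho_inv i : (rho i)^-1 = rho i by apply/eqP; rewrite eq_invg_mul rho_sq.
(* Passing to the inverse makes [y ^+ 2] the commutator of [commutator_star] with [a = rho 1] and
   [b = rho 2]. *)
rewrite -orderV invMg !rho_inv; set y := rho 2 * rho 1.
have o4' := o_ge4.
pose u := rho 1 pt; pose v := rho 2 pt.
have uE : u = o.-1 :> nat by rewrite /u (rho_pt true).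
have vE : v = o.+1 :> nat by rewrite /v rho_right // ptE ltnn subnn addn1.
have neq (a b : 'I_n) : nat_of_ord a != nat_of_ord b -> a != b by [].
have up : u != pt by apply: neq; rewrite uE ptE; lia.
have vp : v != pt by apply: neq; rewrite vE ptE; lia.
have uv : u != v by apply: neq; rewrite uE vE; lia.
have y2 : y ^+ 2 = tperm pt u * tperm pt v.
  rewrite (commutator_star pt_left pt_right left_right (rho_left_on true) (rho_right_on _)) //.
  by rewrite !rho_inv expgS expg1 /y mulgA.
have y21 : y ^+ 2 != 1.
  apply/eqP=> /permP/(_ pt); rewrite y2 permM tpermL tpermD 1?eq_sym // perm1.
  by apply/eqP.
have y6 : y ^+ 6 = 1.
  have tu : tperm pt v u = u by rewrite tpermD 1?eq_sym.
  have tv : tperm pt u v = v by rewrite tpermD // eq_sym.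
  rewrite (expgM y 2 3) y2; apply/permP=> z; rewrite permX perm1 /= !permM.
  have [-> | zp] := eqVneq z pt; first by rewrite !(tpermL, tpermR, tu, tv).
  have [-> | zu] := eqVneq z u; first by rewrite !(tpermL, tpermR, tu, tv).
  have [-> | zv] := eqVneq z v; first by rewrite !(tpermL, tpermR, tu, tv).
  have tz w : z != w -> tperm pt w z = z by move=> zw; rewrite tpermD 1?eq_sym.
  by rewrite !tz.
have y31 : y ^+ 3 != 1.
  (* Path vertices before [pt] are fixed by [rho 2], so [y] acts on them as [rho 1]. *)
  have yE (x : 'I_n) : (x < o)%N -> y x = (if odd x then x.+1 else x.-1)%N :> nat.
    move=> xo; have r2 : rho 2 x = x by apply: ord_inj; rewrite rho_right // xo.
    by rewrite permM r2 (rho_path true) ltnNge ltnW // eqb_id xo.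
  have y1 : y left1 = 2 :> nat by rewrite yE //= (ltn_trans _ o4').
  have y11 : y (y left1) = 1%N :> nat by rewrite yE y1 // (ltn_trans _ o4').
  apply/eqP=> /permP/(_ left1)/(congr1 (@nat_of_ord _)).
  by rewrite permX perm1 /= yE y11 // (ltn_trans _ o4').
have: #[y] \in divisors 6 by rewrite -dvdn_divisors // order_dvdn y6.
rewrite (_ : divisors 6 = [:: 1; 2; 3; 6]%N) // !inE => /or4P[]/eqP ord_y //.
- by rewrite -order_dvdn ord_y in y21.
- by rewrite -order_dvdn ord_y in y21.
by rewrite -order_dvdn ord_y in y31.
Qed.

Lemma rho_schlafli : @schlafli {perm 'I_n} 6 rho = [:: (n - 10)%N; 6; 3; 5; 3].
Proof.
have -> : (n - 10)%N = o.+1 by lia.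
rewrite /schlafli /= order_rot order_rho12.
by rewrite (@order_right 2 3 3) // (@order_right 3 4 5) // (@order_right 4 5 3).
Qed.

End Vertices.

Theorem theorem4p13 (n : nat) :
  (15 <= n)%N -> n %% 4 = 3 ->
  (<<[set rho n (nat_of_ord i) | i : 'I_6]>> \isog 'Alt_('I_n))%g /\
  string_C_group 6 (rho n) /\
  schlafli 6 (rho n) = [:: (n - 10)%N; 6; 3; 5; 3].
Proof.
(* The offset [o = n - 11] is the number of the common vertex [x_{n-10}]. *)
move=> n15 n3; have [o [-> o4 o_gt0]] : exists o, [/\ n = o + 11, 4 %| o & 0 < o]%N.
  by exists (n - 11)%N; split; lia.
split; last by split; [split; [apply: rho_sggi | apply: rho_intersection] | apply: rho_schlafli].
rewrite -(rho_gen_Alt o4 o_gt0) (_ : [set _ | _ : _] = gens_of (rho (o + 11)) [set: 'I_6]) ?isog_refl //.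
by apply/setP=> x; apply/imsetP/imsetP=> -[i _ ->]; exists i.
Qed.
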